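(* Run ARCNC over $\mathbb{F}_q$ on the regular sparsified combination network with $n$ intermediate nodes and $n-m+1$ sinks, each connected to $m$ consecutive intermediate nodes. Put $ET_{UB}(a,q)=\sum_{k=1}^{a}(-1)^{k-1}\binom{a}{k}\frac{1}{q^k-1}$. Then: (i) for a sink $r$, assuming that it is related to the maximum number $2(m-1)$ of other sinks, $E[L_r]< ET_{UB}(3m-2,q)$; (ii) for an intermediate node $v$, $E[L_v]$ is bounded above by $ET_{UB}(2m,q)$; (iii) consequently the expected average memory use $E[W_{\mathrm{avg}}]$ of ARCNC is bounded above by a constant depending only on $m$ and $q$, independent of $n$.
   Context: The regular sparsified combination network has a source $s$, intermediate nodes $v_1,\dots,v_n$ each joined to $s$ by one unit-capacity edge from $s$, and $n-m+1$ sinks $r_1,\dots,r_{n-m+1}$, where sink $r_j$ receives one unit-capacity edge from each of the $m$ consecutive intermediate nodes $v_j,v_{j+1},\dots,v_{j+m-1}$. The source multicasts $m$ independent symbols of the finite field $\mathbb{F}_q$ per unit time. Intermediate nodes only relay, so coding takes place only at the source. Two sinks are related if they share at least one intermediate node as a parent; a sink is related to at most $2(m-1)$ other sinks (fewer if its parents are at the edge of the intermediate layer). ARCNC (adaptive random convolutional network coding) on this network: for the edge from $s$ to $v$, the global encoding kernel is a column vector $f_v(z)=\sum_{i\ge 0}f_{v,i}z^i$ with $f_{v,i}\in\mathbb{F}_q^m$; at each time $t=0,1,2,\dots$ the entries of $f_{v,t}$ are chosen uniformly at random from $\mathbb{F}_q$, independently of everything else, as long as some sink connected to $v$ has not yet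 achieved decodability, and are set to $0$ afterwards. At time $t$, sink $r$ has the $m\times m$ matrix $F_r(z)$ whose columns are the polynomial vectors $\sum_{i=0}^t f_{v,i}z^i$ of its $m$ parents $v$. The first decoding time $T_r$ is the smallest $t\ge0$ for which $F_r(z)$ at time $t$ has full rank $m$. Memory. $L_v$ denotes the degree in $z$, when all sinks are able to decode, of the global encoding kernel matrix $F_v(z)$ at node $v$, whose columns are the global encoding kernels of the incoming edges of $v$ (the source has no incoming edges). Here, for an intermediate node $v$, $L_v=\max T_r$ over all sinks $r$ connected to $v$; for a sink $r$, $L_r=\max T_{r'}$ over $r'=r$ and all sinks $r'$ related to $r$. The average memory use is $W_{\mathrm{avg}}=\frac{\lceil\log_2 q\rceil}{|\mathcal V|}\sum_{v\in\mathcal V}(L_v+1)$, where $\mathcal V$ is the set of all nodes.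
   Formalization: In (i) the strict inequality is stated for m ≥ 2 only; for m = 1 it fails, since then E[L_r] = 1/(q-1) = ET_UB(1,q), and the non-strict bound is stated instead. *)

(* Defs.v *)
From HB Require Import structures.
From mathcomp Require Import all_boot all_order all_algebra.
From mathcomp Require Import all_classical all_reals all_analysis.

Set Implicit Arguments.
Unset Strict Implicit.
Unset Printing Implicit Defensive.

Import Order.TTheory GRing.Theory Num.Theory.

Local Open Scope classical_set_scope.
Local Open Scope ring_scope.

(** * The regular sparsified combination network *)

Notation inter n := 'I_n (only parsing).
Notation sink n m := 'I_(n - m + 1) (only parsing).

(** The source, the intermediate nodes and the sinks. *)
Definition node (n m : nat) : finType := (unit + inter n + sink n m)%type.

Lemma parent_subproof (n m : nat) (hmn : (m <= n)%N) (r : sink n m) (k : 'I_m) :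
  (r + k < n)%N.
Proof.
have hr : (r <= n - m)%N by rewrite -ltnS -[X in (_ < X)%N]addn1 ltn_ord.
apply: (@leq_trans (n - m + m)%N); last by rewrite subnK.
by rewrite -addnS leq_add.
Qed.

(** The [k]-th parent of sink [r]; both are numbered from 0. *)
Definition parent (n m : nat) (hmn : (m <= n)%N) (r : sink n m) (k : 'I_m) :
  inter n := Ordinal (parent_subproof hmn r k).

Definition feeds (n m : nat) (hmn : (m <= n)%N)
    (v : inter n) (r : sink n m) : bool :=
  [exists k : 'I_m, parent hmn r k == v].

Definition related (n m : nat) (hmn : (m <= n)%N) (r r' : sink n m) : bool :=
  (r != r') && [exists v, feeds hmn v r && feeds hmn v r'].

(** * Decoding

    [f v t] is the coefficient of z^t in the global encoding kernel of the edge
    from the source to [v]; nodes relay, so it is also the kernel of the edges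
    leaving [v]. *)

Definition kernel_mx (F : finFieldType) (n m : nat) (hmn : (m <= n)%N)
    (f : inter n -> nat -> 'cV[F]_m) (r : sink n m) (t : nat) :
  'M[{poly F}]_m :=
  \matrix_(a < m, k < m) \poly_(i < t.+1) f (parent hmn r k) i a ord0.

Definition decodable (F : finFieldType) (n m : nat) (hmn : (m <= n)%N)
    (f : inter n -> nat -> 'cV[F]_m) (r : sink n m) (t : nat) : bool :=
  \rank (map_mx (@tofrac {poly F}) (kernel_mx hmn f r t)) == m.

(** "Not yet decoded before time [t]" must look at all the earlier times: the
    kernel matrix of a sink may drop rank after the first decoding time, since
    some of its parents may still be active for other sinks. *)
Definition active (F : finFieldType) (n m : nat) (hmn : (m <= n)%N)
    (f : inter n -> nat -> 'cV[F]_m) (v : inter n) (t : nat) : bool :=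
  [exists r, feeds hmn v r && [forall i : 'I_t, ~~ decodable hmn f r i]].

(** * Random coefficients *)

(** The value type [S] carries the discrete sigma-algebra. *)
Definition discrete_rv (d : measure_display) (Omega : measurableType d)
    (S : Type) (X : Omega -> S) : Prop :=
  forall A : set S, measurable (X @^-1` A).

Definition mutually_independent (R : realType) (d : measure_display)
    (Omega : measurableType d) (P : probability Omega R) (I : eqType)
    (S : Type) (X : I -> Omega -> S) : Prop :=
  forall (s : seq I) (A : I -> set S), uniq s ->
    P (\bigcap_(i in [set` s]) (X i @^-1` A i)) =
    (\prod_(i <- s) P (X i @^-1` A i))%E.

Definition uniform_rv (R : realType) (d : measure_display)
    (Omega : measurableType d) (P : probability Omega R) (F : finFieldType)
    (X : Omega -> F) : Prop :=
  forall c : F, P (X @^-1` [set c]) = ((#|F|%:R)^-1)%:E.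

(** [U (v, t, k)] is the candidate for the [k]-th entry of the coefficient
    chosen for [v] at time [t]; it is used only when [v] is still active.
    As [active _ v t] depends on the coefficients before time [t] only, the
    last clause determines [f] from [U] by recursion on [t]. *)
Definition arcnc (R : realType) (F : finFieldType) (n m : nat)
    (hmn : (m <= n)%N) (d : measure_display) (Omega : measurableType d)
    (P : probability Omega R) (f : Omega -> inter n -> nat -> 'cV[F]_m) :
  Prop :=
  exists U : inter n * nat * 'I_m -> Omega -> F,
    [/\ forall i, discrete_rv (U i),
        forall i, uniform_rv P (U i),
        mutually_independent P U
      & forall w v t, f w v t =
          if active hmn (f w) v t then \col_k U (v, t, k) w else 0].

(** * Decoding times and memory *)

(** The infimum of the empty set is [+oo]: a sink that never decodes has an
    infinite decoding time. *)
Definition decoding_time (R : realType) (F : finFieldType) (n m : nat)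
    (hmn : (m <= n)%N) (f : inter n -> nat -> 'cV[F]_m) (r : sink n m) :
  \bar R :=
  ereal_inf [set (t%:R)%:E | t in [set t : nat | decodable hmn f r t]].

(** The kernel matrix of the source has no columns; its degree is taken to
    be 0. The maxima below are over nonempty sets of nonnegative values, so that
    the neutral element 0 is harmless. *)
Definition memory_degree (R : realType) (F : finFieldType) (n m : nat)
    (hmn : (m <= n)%N) (f : inter n -> nat -> 'cV[F]_m) (x : node n m) :
  \bar R :=
  match x with
  | inl (inl tt) => 0%E
  | inl (inr v) => \big[maxe/0%E]_(r | feeds hmn v r) decoding_time R hmn f r
  | inr r => \big[maxe/0%E]_(r' | (r' == r) || related hmn r r')
               decoding_time R hmn f r'
  end.

Definition inter_degree (R : realType) (F : finFieldType) (n m : nat)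
    (hmn : (m <= n)%N) (f : inter n -> nat -> 'cV[F]_m) (v : inter n) :
  \bar R := memory_degree R hmn f (inl (inr v)).

Definition sink_degree (R : realType) (F : finFieldType) (n m : nat)
    (hmn : (m <= n)%N) (f : inter n -> nat -> 'cV[F]_m) (r : sink n m) :
  \bar R := memory_degree R hmn f (inr r).

Definition average_memory (R : realType) (F : finFieldType) (n m : nat)
    (hmn : (m <= n)%N) (f : inter n -> nat -> 'cV[F]_m) : \bar R :=
  (((Num.ceil (ln (#|F|%:R : R) / ln 2))%:~R / #|{: node n m}|%:R)%:E *
   \sum_(x : node n m) (memory_degree R hmn f x + 1))%E.

Definition ET_UB (R : realType) (a q : nat) : R :=
  \sum_(1 <= k < a.+1)
    (-1) ^+ (k - 1) * 'C(a, k)%:R * (q%:R ^+ k - 1)^-1.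

(* Main.v *)
Require Import Defs.
From HB Require Import structures.
From mathcomp Require Import all_boot all_order all_algebra.
From mathcomp Require Import all_classical all_reals all_analysis.
From mathcomp Require Import measurable_realfun.
From mathcomp Require Import zify ring.

(** As long as a sink has not decoded, all its parents are active; so its first
    decoding time is the same as if the candidate coefficients [U] were used
    forever, and it is at most the number of times [t] at which the kernel
    matrix built from [U] up to time [t] is singular. Consider the sinks all of
    whose parents lie among [b] consecutive intermediate nodes. Choosing the
    kernels of these nodes one after the other, all those sinks have full rank
    at time [t] as soon as each new kernel avoids the span over F(z) of the
    [m - 1] preceding ones. With Q = q^(t+1) candidates per coordinate, a proper
    subspace contains at most Q^(m-1) of the Q^m kernels, so this happens with
    probability at least (1 - 1/Q)^b, strictly more if [m > 1] since the first
    kernel need only be nonzero. Summing 1 - (1 - q^-(t+1))^b over [t] gives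
    ET_UB(b, q). For a sink and its related sinks [b <= 3m-2]; for the sinks
    fed by an intermediate node [b <= 2m-1]. *)

Set Implicit Arguments.
Unset Strict Implicit.
Unset Printing Implicit Defensive.

Import Order.TTheory GRing.Theory Num.Theory.
Import numFieldNormedType.Exports.

Local Open Scope ring_scope.

(** * Counting sequences built one element at a time *)

Section GoodSeq.
Variables (T : finType) (ok : seq T -> pred T).

(** The head is the latest choice and the tail holds the earlier ones. *)
Fixpoint good_seq (s : seq T) : bool :=
  if s is x :: s' then good_seq s' && ok s' x else true.

Lemma good_seq_drop i s : good_seq s -> good_seq (drop i s).
Proof.
by elim: s i => [|x s IH] [|i] //= /andP[gs _]; exact: IH.
Qed.

Lemma card_good_seq_cons a c :
  (forall s, size s = a -> (c <= #|[set x | ok s x]|)%N) ->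
  (#|[set s : a.-tuple T | good_seq s]| * c <=
    #|[set s : a.+1.-tuple T | good_seq s]|)%N.
Proof.
move=> hc; pose h (p : a.-tuple T * T) : a.+1.-tuple T := cons_tuple p.2 p.1.
have hinj : injective h.
  by move=> [s x] [s' x'] /(congr1 val) /= [-> /val_inj ->].
have -> : #|[set s : a.+1.-tuple T | good_seq s]| =
    #|[set p : a.-tuple T * T | good_seq p.1 && ok p.1 p.2]|.
  rewrite -(card_imset _ hinj); apply: eq_card => s; rewrite !inE.
  apply/idP/imsetP => [|[[s' x]]].
    case/tupleP: s => x s /= /andP[gs os]; exists (s, x); last exact/val_inj.
    by rewrite !inE /= gs.
  by rewrite !inE /= => /andP[gs os] -> /=; rewrite gs.
rewrite -[X in (_ <= X)%N]sum1dep_card.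
rewrite -(pair_big_dep (fun s : a.-tuple T => good_seq s)
  (fun s x => ok s x) (fun _ _ => 1%N)) /=.
rewrite -sum_nat_cond_const; apply: leq_sum => s _.
by rewrite sum1dep_card; apply: hc; rewrite size_tuple.
Qed.

(** The first choice is counted apart: for kernels its constraint is weaker than the later ones, and
    strict bounds will come from there. *)
Lemma card_good_seq a c :
  (forall s, (c <= #|[set x | ok s x]|)%N) ->
  (#|[set x | ok [::] x]| * c ^ a <=
    #|[set s : a.+1.-tuple T | good_seq s]|)%N.
Proof.
move=> hc; elim: a => [|a IH].
  rewrite expn0 muln1.
  apply: leq_trans (@card_good_seq_cons 0 #|[set x | ok [::] x]| _);
    last by move=> s /size0nil->.
  rewrite leq_pmull// card_gt0; apply/set0Pn.
  by exists [tuple]; rewrite inE.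
rewrite expnSr mulnA; apply: leq_trans (card_good_seq_cons (fun s _ => hc s)).
by rewrite leq_mul2r IH orbT.
Qed.

End GoodSeq.

(** * Kernels truncated at degree [t], as vectors over F(z) *)

Section KernelVectors.
Variables (F : finFieldType) (m t : nat).
Local Notation K := {fraction {poly F}}.
Local Notation V := 'M[F]_(m, t.+1).

(** Row [k] of [x] lists the coefficients of the [k]-th entry of a kernel, a polynomial of degree at
    most [t]. *)
Definition kernel_vec (x : V) : 'cV[K]_m :=
  \col_k tofrac (rVpoly (row k x)).

Lemma kernel_vecB : {morph kernel_vec : x y / x - y}.
Proof.
by move=> x y; apply/colP => k; rewrite !mxE !raddfB.
Qed.

(** Only the latest [m - 1] choices matter, since a sink sees [m] consecutive nodes. *)
Definition off_span (s : seq V) : pred V :=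
  fun x => kernel_vec x \notin <<map kernel_vec (take m.-1 s)>>%VS.

Lemma free_kernel_vec s :
  good_seq off_span s -> free (map kernel_vec (take m s)).
Proof.
elim: s => [|x s IH]; first by rewrite nil_free.
have [m0|m0] := posnP m; first by rewrite [X in take X]m0 take0 nil_free.
have takeS k : (0 < k)%N -> take k (x :: s) = x :: take k.-1 s by case: k.
rewrite takeS//.
move=> /= /andP[/IH fs os]; rewrite free_cons; apply/andP; split=> //.
(* The [m - 1] choices preceding [x] are a prefix of those that are free by induction. *)
move: fs; rewrite -(cat_take_drop m.-1 (take m s)) map_cat => /catl_free.
by rewrite take_takel ?leq_pred.
Qed.

(* A nonzero linear form [phi] vanishing on the span determines the [k]-th
   coordinate, [phi k != 0], of an element of the span from the other ones. *)
Lemma card_in_span (s : seq V) : (0 < m)%N ->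
  (#|[set x | ~~ off_span s x]| <= #|F| ^ (m.-1 * t.+1))%N.
Proof.
move=> m0; set X := map kernel_vec (take m.-1 s).
(* [phi] comes from the left kernel of the matrix with columns [X]: at most [m - 1] columns for [m]
   rows. *)
have [phi [phi0 phiX]] : exists phi : 'rV[K]_m,
    phi != 0 /\ {in <<X>>%VS, forall v, phi *m v = 0}.
  pose B : 'M[K]_(m, size X) := \matrix_(i, j) X`_j i ord0.
  have : kermx B != 0.
    rewrite kermx_eq0 -row_leq_rank -ltnNge.
    apply: leq_ltn_trans (rank_leq_col _) _.
    by rewrite size_map size_take_min (leq_ltn_trans (geq_minl _ _))// prednK.
  move=> /rowV0Pn[phi /sub_kermxP phiB phi0]; exists phi; split=> // v vX.
  rewrite (coord_span (X := in_tuple X) vX) mulmx_sumr big1// => j _.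
  rewrite -scalemxAr (_ : phi *m _ = 0) ?scaler0//.
  apply/matrixP => a b; rewrite !ord1.
  transitivity ((phi *m B) ord0 j); last by rewrite phiB !mxE.
  by rewrite !mxE; apply: eq_bigr => i _; rewrite mxE.
have [k phik] : exists k, phi ord0 k != 0.
  apply/existsP; apply: contraNT phi0; rewrite negb_exists => /forallP h.
  by apply/eqP/rowP => k; rewrite mxE; apply/eqP; have := h k; rewrite negbK.
rewrite -card_mx -(@card_in_imset _ _ (@row' F m t.+1 k)) ?max_card// => x y.
rewrite !inE !negbK => xX yX exy.
have exyi i : i != k -> row i x = row i y.
  move=> ik; case: (unliftP k i) => [j ->|/eqP]; last by rewrite (negPf ik).
  by apply/rowP => b; move/matrixP: exy => /(_ j b); rewrite !mxE.
have : phi *m kernel_vec (x - y) = 0.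
  by rewrite kernel_vecB; apply: phiX; rewrite rpredB.
move/matrixP => /(_ ord0 ord0); rewrite !mxE (bigD1 k)//= big1 => [|i ik].
  rewrite addr0 mxE => /eqP; rewrite mulf_eq0 (negPf phik) /= tofrac_eq0.
  move=> /eqP /(congr1 (@poly_rV _ t.+1)); rewrite rVpolyK linear0 linearB /=.
  move=> /eqP; rewrite subr_eq0 => /eqP exyk.
  apply/row_matrixP => i; have [->//|] := eqVneq i k; exact: exyi.
by rewrite mxE linearB /= exyi// subrr linear0 tofrac0 mulr0.
Qed.

Lemma card_off_span (s : seq V) : (0 < m)%N ->
  (#|F| ^ (m * t.+1) - #|F| ^ (m.-1 * t.+1) <= #|[set x | off_span s x]|)%N.
Proof.
move=> m0; rewrite leq_subLR addnC -card_mx.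
rewrite -(cardsC [set x | off_span s x]) leq_add2l.
rewrite (_ : ~: _ = [set x | ~~ off_span s x]) ?card_in_span//.
by apply/setP => x; rewrite !inE.
Qed.

Lemma card_off_span_nil :
  #|[set x | off_span [::] x]| = (#|F| ^ (m * t.+1) - 1)%N.
Proof.
rewrite -card_mx subn1 -(cardC1 (0 : V)); apply: eq_card => x.
rewrite !inE /off_span /= span_nil memv0; congr (~~ _).
apply/eqP/eqP => [h|->]; last first.
  by apply/colP => k; rewrite !mxE raddf0 linear0 tofrac0.
apply/row_matrixP => k; rewrite raddf0; move/colP: h => /(_ k); rewrite !mxE.
by move=> /eqP; rewrite tofrac_eq0 => /eqP /(congr1 (@poly_rV _ t.+1));
  rewrite rVpolyK linear0.
Qed.

Lemma rank_free_cols (s : seq V) (i : 'I_m -> V) :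
  size s = m -> (forall k : 'I_m, nth 0 s k = i k) ->
  free (map kernel_vec s) ->
  \rank (\matrix_(a, k) kernel_vec (i k) a ord0) = m.
Proof.
move=> ss si fs; rewrite -mxrank_tr; apply/eqP; apply: inj_row_free => v vA.
have sz : size (map kernel_vec s) == m by rewrite size_map ss.
have /freeP frees : free (Tuple sz) by [].
apply/rowP => k; rewrite mxE; apply: (frees (v ord0)).
apply/colP => a.
transitivity ((v *m (\matrix_(a, k) kernel_vec (i k) a ord0)^T) ord0 a);
  last by rewrite vA !mxE.
rewrite summxE !mxE; apply: eq_bigr => j _.
by rewrite !mxE (nth_map 0) ?ss ?ltn_ord// si mxE.
Qed.

End KernelVectors.

(** * Good choices on a window of nodes make its sinks decode *)

Section Window.
Variables (F : finFieldType) (n m : nat) (hmn : (m <= n)%N) (t : nat).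

Definition coef_mx (g : nat -> 'cV[F]_m) : 'M[F]_(m, t.+1) :=
  \matrix_(k, j) g j k ord0.

(** Position [i] holds node [lo + i], so nodes are chosen from right to left. The parents of [r] are
    the [m] latest choices of the suffix starting at [r - lo], which is again good. *)
Lemma decodable_good_seq (g : inter n -> nat -> 'cV[F]_m) (lo b : nat)
    (s : b.-tuple 'M[F]_(m, t.+1)) (r : sink n m) :
  (forall (i : 'I_b) (v : inter n), v = (lo + i)%N :> nat ->
     tnth s i = coef_mx (g v)) ->
  good_seq (@off_span F m t) s -> (lo <= r)%N -> (r + m <= lo + b)%N ->
  decodable hmn g r t.
Proof.
move=> sg gs lor rb; apply/eqP.
have -> : map_mx (@tofrac {poly F}) (kernel_mx hmn g r t) =
    \matrix_(a, k) kernel_vec (coef_mx (g (parent hmn r k))) a ord0.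
  apply/matrixP => a k; rewrite !mxE; congr tofrac; apply/polyP => i.
  rewrite !coef_poly; case: ltnP => // it.
  by rewrite insubT !mxE.
apply: (rank_free_cols (s := take m (drop (r - lo) s))).
- by rewrite size_takel// size_drop size_tuple; lia.
- move=> k; rewrite nth_take ?ltn_ord// nth_drop.
  have h : (r - lo + k < b)%N by have := ltn_ord k; lia.
  rewrite -(tnth_nth _ s (Ordinal h)); apply: sg => /=.
  lia.
- exact/free_kernel_vec/good_seq_drop.
Qed.

(** Were [r] undecoded under [f] through time [t], its parents would all be active, and [f] and [g]
    would give it the same kernel matrix. *)
Lemma decodable_before (f g : inter n -> nat -> 'cV[F]_m) (r : sink n m) :
  (forall v t', f v t' = if active hmn f v t' then g v t' else 0) ->
  decodable hmn g r t -> exists2 t', (t' <= t)%N & decodable hmn f r t'.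
Proof.
move=> fE gt; apply/exists2P; apply: contrapT => /forallNP nf.
have nfi i : (i <= t)%N -> ~~ decodable hmn f r i.
  by move=> it; apply/negP => fi; apply: (nf i).
have /negP := nfi t (leqnn t); apply.
suff -> : decodable hmn f r t = decodable hmn g r t by [].
congr (\rank (map_mx _ _) == _); apply/matrixP => a k; rewrite !mxE.
apply/polyP => i; rewrite !coef_poly; case: ltnP => // it.
rewrite fE (_ : active _ _ _ _)//; apply/existsP; exists r.
apply/andP; split; first by apply/existsP; exists k.
by apply/forallP => j; apply: nfi; have := ltn_ord j; lia.
Qed.

End Window.

(** * The series that sums to [ET_UB] *)

Section ExpectedMaximum.
Variables (R : realType) (q : nat).
Hypothesis q1 : (1 < q)%N.

(** The probability that the maximum of [a] independent geometric variables, each with P(X <= t) = 1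
    - q^-(t+1), exceeds [t]. *)
Definition tail_UB (a t : nat) : R := 1 - (1 - (q%:R ^+ t.+1)^-1) ^+ a.

(** In the binomial expansion the term [k = 0] cancels the leading 1; the others are geometric in
    [t]. *)
Lemma tail_UBE a t : tail_UB a t = \sum_(1 <= k < a.+1)
  ((-1) ^+ (k - 1) * 'C(a, k)%:R * (q%:R ^+ k)^-1) * ((q%:R ^+ k)^-1) ^+ t.
Proof.
rewrite /tail_UB exprBn -(big_mkord xpredT
  (fun i => (-1) ^+ i * 1 ^+ (a - i) * (q%:R ^+ t.+1)^-1 ^+ i *+ 'C(a, i))).
rewrite big_ltn// bin0 !expr0 expr1n !mulr1 mulr1n opprD addrA subrr add0r.
rewrite -sumrN; apply: eq_big_nat => k /andP[k1 _].
rewrite -[in RHS]mulrA -[in RHS]exprS -!exprVn -!exprM [(k * _)%N]mulnC.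
by rewrite expr1n mulr1 -mulr_natr; case: k k1 => // k _;
  rewrite subn1 /= exprS; ring.
Qed.

Lemma tail_UB_ge0 a t : 0 <= tail_UB a t.
Proof.
have q0 : (0 : R) < q%:R ^+ t.+1 by rewrite exprn_gt0// ltr0n; lia.
rewrite subr_ge0 exprn_ile1// ?subr_ge0 ?gerBl ?invr_ge0 ?(ltW q0)//.
by rewrite invf_le1// exprn_ege1// ler1n; lia.
Qed.

Lemma tail_UB_le a b t : (a <= b)%N -> tail_UB a t <= tail_UB b t.
Proof.
have q0 : (0 : R) < q%:R ^+ t.+1 by rewrite exprn_gt0// ltr0n; lia.
move=> ab; rewrite lerD2l lerN2 ler_wiXn2l ?subr_ge0 ?gerBl ?invr_ge0 ?(ltW q0)//.
by rewrite invf_le1// exprn_ege1// ler1n; lia.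
Qed.

(** Makes [0 < k] available to termwise arguments: at [k = 0] the geometric ratio q^-k would be
    1. *)
Lemma big_nat1_gt0 a (G : nat -> R) :
  \sum_(1 <= k < a.+1) G k = \sum_(1 <= k < a.+1 | (0 < k)%N) G k.
Proof.
by rewrite [LHS]big_nat_cond [RHS]big_nat_cond; apply: eq_bigl => -[|k];
  rewrite /= ?andbT.
Qed.

Lemma cvg_tail_UB a :
  (series (tail_UB a) x @[x --> \oo] --> (ET_UB R a q : R))%classic.
Proof.
have -> : series (tail_UB a) = fun N => \sum_(1 <= k < a.+1 | (0 < k)%N)
    series (geometric ((-1) ^+ (k - 1) * 'C(a, k)%:R * (q%:R ^+ k)^-1)
                      ((q%:R ^+ k)^-1 : R)) N.
  apply/funext => N; rewrite /series /= exchange_big /=.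
  by apply: eq_bigr => t _; rewrite tail_UBE big_nat1_gt0.
have -> : ET_UB R a q = \sum_(1 <= k < a.+1 | (0 < k)%N)
    ((-1) ^+ (k - 1) * 'C(a, k)%:R * (q%:R ^+ k)^-1) / (1 - (q%:R ^+ k)^-1).
  rewrite /ET_UB big_nat1_gt0; apply: eq_bigr => k k1.
  rewrite -!mulrA; congr (_ * (_ * _)).
  have q0 : (0 : R) < q%:R by rewrite ltr0n; lia.
  have qk : (1 : R) < q%:R ^+ k by rewrite exprn_egt1 ?ltr1n//; lia.
  by field; rewrite (gt_eqF (lt_trans ltr01 qk)) subr_eq0 (gt_eqF qk).
apply: (@cvg_big R^o nat +%R 0 (fun k => (0 < k)%N) (@add_continuous R^o)).
move=> k k0.
apply: cvg_geometric_series.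
have qk : (1 : R) < q%:R ^+ k by rewrite exprn_egt1 ?ltr1n//; lia.
have q0 := lt_trans ltr01 qk.
by rewrite ger0_norm ?invr_ge0 ?(ltW q0)// invf_lt1.
Qed.

Lemma nneseries_tail_UB a :
  (\sum_(0 <= t <oo) (tail_UB a t)%:E = (ET_UB R a q)%:E)%E.
Proof.
have h := @cvg_tail_UB a.
rewrite -(cvg_lim (@Rhausdorff R) h) -EFin_lim.
  by congr (limn _); apply/funext => N; rewrite /= -sumEFin.
by apply/cvg_ex; exists (ET_UB R a q); exact: h.
Qed.

(** Hidden by the alternating signs, but clear term by term on the series of [tail_UB]. *)
Lemma ET_UB_le a b : (a <= b)%N -> ET_UB R a q <= ET_UB R b q.
Proof.
move=> ab; rewrite -lee_fin -!nneseries_tail_UB; apply: lee_nneseries => t *.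
  by rewrite lee_fin tail_UB_ge0.
by rewrite lee_fin tail_UB_le.
Qed.

End ExpectedMaximum.

(** * Joint law of finitely many candidate coefficients *)

Section Uniform.
Variables (R : realType) (d : measure_display) (Omega : measurableType d).
Variables (P : probability Omega R) (F : finFieldType) (I : eqType).
Variable U : I -> Omega -> F.
Hypotheses (dU : forall i, discrete_rv (U i)) (uU : forall i, uniform_rv P (U i)).
Hypothesis iU : mutually_independent P U.
Variables (J : finType) (h : J -> I).
Hypothesis hinj : injective h.
Local Open Scope classical_set_scope.

Definition joint (w : Omega) : {ffun J -> F} := [ffun j => U (h j) w].

Lemma joint_fiber (s : {ffun J -> F}) :
  measurable (joint @^-1` [set s]) /\
  P (joint @^-1` [set s]) = ((#|F|%:R ^+ #|J|)^-1)%:E.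
Proof.
(* Independence asks for a set at every index of [I]: off the image of [h] the condition is vacuous,
   on it injectivity leaves a singleton. *)
pose A i : set F := [set c | forall j, h j = i -> c = s j].
have Ah j : A (h j) = [set s j].
  by apply/seteqP; split=> c; [exact|move=> -> k /hinj ->].
have E : joint @^-1` [set s] =
    \bigcap_(i in [set` map h (enum J)]) (U i @^-1` A i).
  apply/seteqP; split=> w /=.
    by move=> ws i _ j <-; rewrite -ws ffunE.
  move=> wA; apply/ffunP => j; rewrite ffunE; apply: (wA (h j)) => //=.
  by rewrite map_f// mem_enum.
rewrite E; split.
  by apply: fin_bigcap_measurable => // i _; exact: dU.
rewrite iU; last by rewrite map_inj_uniq ?enum_uniq.
rewrite big_map big_enum.
under eq_bigr do rewrite Ah uU.
by rewrite prodEFin prodr_const exprVn.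
Qed.

Lemma joint_uniform (A : {set {ffun J -> F}}) :
  measurable (joint @^-1` [set` A]) /\
  P (joint @^-1` [set` A]) = (#|A|%:R / #|F|%:R ^+ #|J|)%:E.
Proof.
have -> : joint @^-1` [set` A] =
    \bigcup_(s in [set` enum A]) (joint @^-1` [set s]).
  apply/seteqP; split=> w /=.
    by move=> wA; exists (joint w); rewrite /= ?mem_enum.
  by move=> [s /=]; rewrite mem_enum => sA ->.
have mf s : measurable (joint @^-1` [set s]) by have [] := joint_fiber s.
split; first by apply: fin_bigcup_measurable.
rewrite measure_fin_bigcup//; last by move=> i j _ _ [w [<- <-]].
rewrite -fsbig_seq ?enum_uniq// big_enum /=.
under eq_bigr do rewrite (joint_fiber _).2.
by rewrite sumEFin sumr_const mulr_natl.
Qed.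

End Uniform.

(** * Proportion of good sequences *)

Section GoodRatio.
Variables (R : realType) (F : finFieldType) (m t : nat).
Hypothesis m0 : (0 < m)%N.
Let y : R := (#|F|%:R ^+ t.+1)^-1.
Local Notation G b :=
  #|[set s : b.-tuple 'M[F]_(m, t.+1) | good_seq (@off_span F m t) s]|.

Let q0 : (0 : R) < #|F|%:R.
Proof. by rewrite ltr0n (ltn_trans _ (card_finNzRing_gt1 F)). Qed.

Let y0 : 0 < y.
Proof. by rewrite invr_gt0 exprn_gt0. Qed.

Let y1 : y < 1.
Proof.
by rewrite invf_lt1 ?exprn_gt0// exprn_egt1// ltr1n card_finNzRing_gt1.
Qed.

Lemma card_good_ratio b :
  (1 - y ^+ m) * (1 - y) ^+ b <=
    (G b.+1)%:R / #|F|%:R ^+ (b.+1 * (t.+1 * m)).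
Proof.
have F0 : (0 < #|F|)%N by rewrite (ltn_trans _ (card_finNzRing_gt1 F)).
rewrite ler_pdivlMr ?exprn_gt0//.
apply: le_trans (_ : _ <= ((#|F| ^ (m * t.+1) - 1) *
  (#|F| ^ (m * t.+1) - #|F| ^ (m.-1 * t.+1)) ^ b)%:R) _; last first.
  rewrite ler_nat -card_off_span_nil; apply: card_good_seq => s.
  exact: card_off_span.
rewrite natrM natrX !natrB ?expn_gt0 ?F0//; last first.
  by rewrite leq_pexp2l// leq_mul2r leq_pred orbT.
set Q : R := #|F|%:R ^+ t.+1.
have Q0 : Q != 0 by rewrite expf_neq0// gt_eqF.
have QE k : (#|F| ^ (k * t.+1))%:R = Q ^+ k by rewrite natrX mulnC exprM.
rewrite !QE (_ : #|F|%:R ^+ _ = Q ^+ m * (Q ^+ m) ^+ b); last first.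
  by rewrite -!exprM -exprD; congr (_ ^+ _); lia.
rewrite mulrACA -exprMn !mulrBl !mul1r /y -/Q exprVn mulVf ?(expf_neq0 _ Q0)//.
have -> : Q^-1 * Q ^+ m = Q ^+ m.-1 by rewrite -[in LHS](prednK m0) exprS mulKf.
by rewrite mul1r.
Qed.

Lemma card_good_ge b :
  (1 - y) ^+ b <= (G b)%:R / #|F|%:R ^+ (b * (t.+1 * m)).
Proof.
case: b => [|b].
  rewrite mul0n !expr0 divr1 ler1n card_gt0; apply/set0Pn.
  by exists [tuple]; rewrite inE.
apply: le_trans (card_good_ratio b); rewrite exprS ler_wpM2r//.
  by rewrite exprn_ge0// subr_ge0 ltW.
by rewrite lerD2l lerN2 -[leRHS]expr1 ler_wiXn2l ?ltW.
Qed.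

(** The first kernel contributes the factor [1 - y ^+ m], which exceeds [1 - y] once [m > 1]. *)
Lemma card_good_gt b : (1 < m)%N -> (0 < b)%N ->
  (1 - y) ^+ b < (G b)%:R / #|F|%:R ^+ (b * (t.+1 * m)).
Proof.
case: b => // b m1 _.
apply: lt_le_trans (card_good_ratio b); rewrite exprS ltr_pM2r.
  by rewrite ltrD2l ltrN2 -[ltRHS]expr1 ltr_iXn2l.
by rewrite exprn_gt0// subr_gt0.
Qed.

End GoodRatio.

(** The integral of a nonnegative function is a supremum over the simple functions below it, and a
    larger function has more of them. This serves for memory degrees, whose measurability is not
    established. *)
Lemma ge0_le_integral_nonmeasurable (R : realType) (d : measure_display)
    (T : measurableType d) (mu : {measure set T -> \bar R}) (f g : T -> \bar R) :
  (forall x, 0 <= f x)%E -> (forall x, f x <= g x)%E ->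
  (\int[mu]_x f x <= \int[mu]_x g x)%E.
Proof.
move=> f0 fg; have g0 x : (0 <= g x)%E := le_trans (f0 x) (fg x).
rewrite !ge0_integralTE//; apply: ereal_sup_le => _ [h hf <-].
by exists h => // x; exact: le_trans (fg x).
Qed.

(** * Decoding times of the sinks in a window *)

Section Windows.
Variables (R : realType) (F : finFieldType) (n m : nat).
Hypotheses (m0 : (0 < m)%N) (hmn : (m <= n)%N).
Variables (d : measure_display) (Omega : measurableType d).
Variables (P : probability Omega R) (f : Omega -> inter n -> nat -> 'cV[F]_m).
Hypothesis hf : arcnc hmn P f.
Let q1 : (1 < #|F|)%N := card_finNzRing_gt1 F.

(** [B] is the event that the candidates up to time [t] on the [b] nodes from [lo] on do not form a
    good sequence. *)
Lemma window_event lo b t : (lo + b <= n)%N -> exists B : set Omega,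
  [/\ measurable B,
      forall w (r : sink n m), ~ B w -> (lo <= r)%N -> (r + m <= lo + b)%N ->
        exists2 t', (t' <= t)%N & decodable hmn (f w) r t',
      (P B <= (tail_UB R #|F| b t)%:E)%E
    & (1 < m)%N -> (0 < b)%N -> (P B < (tail_UB R #|F| b t)%:E)%E].
Proof.
move=> lobn; have [U [dU uU iU fE]] := hf.
have vlt (i : 'I_b) : (lo + i < n)%N by have := ltn_ord i; lia.
pose J : finType := ('I_b * 'I_t.+1 * 'I_m)%type.
pose h (x : J) : inter n * nat * 'I_m :=
  (Ordinal (vlt x.1.1), val x.1.2, x.2).
have hinj : injective h.
  move=> [[i j] k] [[i' j'] k'] [] /= /addnI /val_inj -> /val_inj -> ->.
  by [].
pose S (x : {ffun J -> F}) : b.-tuple 'M[F]_(m, t.+1) :=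
  [tuple \matrix_(k, j) x (i, j, k) | i < b].
pose A := [set x | good_seq (@off_span F m t) (S x)]%SET.
have [mA PA] := joint_uniform dU uU iU hinj A.
set X := (joint U h @^-1` [set` A])%classic in mA PA.
have cardJ : #|J| = (b * (t.+1 * m))%N by rewrite !card_prod !card_ord mulnA.
have PAE : P (~` X)%classic = (1 - #|A|%:R / #|F|%:R ^+ (b * (t.+1 * m)))%:E.
  by rewrite probability_setC// PA cardJ EFinB.
(* Every good tuple is the image under [S] of some element of [A], so lower bounds on good tuples
   carry over to [A]. *)
have leA : (#|[set s : b.-tuple 'M[F]_(m, t.+1) |
    good_seq (@off_span F m t) s]%SET| <= #|A|)%N.
  apply: leq_trans (leq_imset_card S A); apply: subset_leq_card.
  apply/fintype.subsetP => s; rewrite inE => gs; apply/imsetP.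
  have Ss : S [ffun x => tnth s x.1.1 x.2 x.1.2] = s.
    apply: eq_from_tnth => i; rewrite tnth_mktuple.
    by apply/matrixP => k j; rewrite mxE ffunE.
  by exists [ffun x => tnth s x.1.1 x.2 x.1.2]; rewrite ?inE Ss.
have qp : (0 : R) < #|F|%:R ^+ (b * (t.+1 * m)).
  by rewrite exprn_gt0// ltr0n; lia.
exists (~` X)%classic; split.
- exact: measurableC.
- move=> w r; rewrite /setC /= => /contrapT Xw lor rb.
  apply: (@decodable_before _ _ _ _ _ _ (fun v j => \col_k U (v, j, k) w)) => //.
  move: Xw; rewrite /X /= inE => gs.
  apply: decodable_good_seq gs lor rb => i v vi.
  rewrite tnth_mktuple; apply/matrixP => k j; rewrite !mxE ffunE /h /=.
  by congr (U (_, _, _) w); apply: val_inj; rewrite /= vi.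
- rewrite PAE lee_fin lerD2l lerN2.
  apply: le_trans (card_good_ge R F t m0 b) _.
  by rewrite ler_pM2r ?invr_gt0// ler_nat.
- move=> m1 b0; rewrite PAE lte_fin ltrD2l ltrN2.
  apply: lt_le_trans (card_good_gt R F t m0 m1 b0) _.
  by rewrite ler_pM2r ?invr_gt0// ler_nat.
Qed.

(** [H] counts the times [t] at which [B t] occurs. If [N] is the first time without it, the [N]
    earlier times are all counted, and the sink has decoded by [N]. *)
Lemma window_time lo b : (lo + b <= n)%N -> exists H : Omega -> \bar R,
  [/\ measurable_fun setT H, forall w, (0 <= H w)%E,
      forall w (r : sink n m), (lo <= r)%N -> (r + m <= lo + b)%N ->
        (decoding_time R hmn (f w) r <= H w)%E,
      (\int[P]_w H w <= (ET_UB R b #|F|)%:E)%E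
    & (1 < m)%N -> (0 < b)%N -> (\int[P]_w H w < (ET_UB R b #|F|)%:E)%E].
Proof.
move=> lobn; have [B hB] := choice (fun t => window_event t lobn).
have mB t : measurable (B t) by have [] := hB t.
have B0 t w : (0 <= (\1_(B t) w : R)%:E)%E by rewrite lee_fin.
have mI t : measurable_fun setT (fun w => (\1_(B t) w : R)%:E).
  by apply/measurable_EFinP; exact: measurable_indic.
pose H w := (\sum_(0 <= t <oo) (\1_(B t) w : R)%:E)%E.
have HN w N : (forall t, (t < N)%N -> B t w) -> (N%:R%:E <= H w)%E.
  move=> hN; apply: le_trans (nneseries_lim_ge N (fun t _ _ => B0 t w)).
  rewrite big_mkord (eq_bigr (fun=> 1%:E)) ?sumEFin ?sumr_const ?card_ord//.
  by move=> t _; rewrite indicE mem_set//; apply: hN.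
have intH : (\int[P]_w H w = \sum_(0 <= t <oo) P (B t))%E.
  rewrite integral_nneseries//; apply: eq_eseriesr => t _.
  by rewrite integral_indic// setIT.
exists H; split.
- exact: (ge0_emeasurable_sum (P := xpredT)).
- by move=> w; apply: nneseries_ge0.
- move=> w r lor rb.
  have [[t nBt]|nB] := pselect (exists t, ~ B t w).
    have ex : exists t, `[< ~ B t w >] by exists t; apply/asboolP.
    case: (ex_minnP ex) => N /asboolP nBN Nmin.
    have [t' t'N dt'] := (let: And4 _ h _ _ := hB N in h) w r nBN lor rb.
    apply: le_trans (_ : _ <= N%:R%:E)%E _.
      apply: le_trans (_ : _ <= t'%:R%:E)%E _; last by rewrite lee_fin ler_nat.
      by apply: ereal_inf_lbound; exists t'.
    apply: HN => s sN; apply: contrapT => nBs.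
    by have := Nmin s (asboolT nBs); rewrite leqNgt sN.
  suff -> : H w = +oo%E by rewrite leey.
  apply/eqyP => A A0; apply: le_trans (HN w (Num.bound A) _).
    by rewrite lee_fin ltW// archi_boundP// ltW.
  by move=> t _; apply: contrapT => nBt; apply: nB; exists t.
- rewrite intH -nneseries_tail_UB//; apply: lee_nneseries => // t _.
  by have [] := hB t.
- move=> m1 b0; rewrite intH -nneseries_tail_UB//.
  have PB t : (P (B t) <= (tail_UB R #|F| b t)%:E)%E by have [] := hB t.
  have tail0 t : (0 <= (tail_UB R #|F| b t)%:E)%E.
    by rewrite lee_fin tail_UB_ge0.
  (* The term at [t = 0] is strictly smaller; finiteness of the remaining sum preserves
     strictness. *)
  rewrite [ltLHS]nneseries_recl// [ltRHS]nneseries_recl//.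
  apply: lte_leD.
  + rewrite ge0_fin_numE; last exact: nneseries_ge0.
    apply: (@le_lt_trans _ _ (ET_UB R b #|F|)%:E); last exact: ltry.
    rewrite -nneseries_tail_UB// [leRHS]nneseries_recl//.
    by apply: le_trans (lee_nneseries _ _) (leeDr _ _).
  + have [_ _ _] := hB 0%N; exact.
  + by apply: lee_nneseries.
Qed.

End Windows.

(** * Windows attached to nodes, and the memory bounds *)

Lemma feedsP (n m : nat) (hmn : (m <= n)%N) (v : inter n) (r : sink n m) :
  feeds hmn v r -> (r <= v < r + m)%N.
Proof. by move=> /existsP[k /eqP <-] /=; have := ltn_ord k; lia. Qed.

Lemma related_dist (n m : nat) (hmn : (m <= n)%N) (r r' : sink n m) :
  related hmn r r' -> (r < r' + m)%N && (r' < r + m)%N.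
Proof.
by move=> /andP[_ /existsP[v /andP[/feedsP h /feedsP h']]]; lia.
Qed.

Section MemoryDegree.
Variables (R : realType) (F : finFieldType) (n m : nat).
Hypotheses (m0 : (0 < m)%N) (hmn : (m <= n)%N).
Variables (d : measure_display) (Omega : measurableType d).
Variables (P : probability Omega R) (f : Omega -> inter n -> nat -> 'cV[F]_m).
Hypothesis hf : arcnc hmn P f.
Let q1 : (1 < #|F|)%N := card_finNzRing_gt1 F.

Lemma memory_degree_ge0 w (x : node n m) :
  (0 <= memory_degree R hmn (f w) x)%E.
Proof. by case: x => [[[]|v]|r] //=; exact: bigmax_ge_id. Qed.

Lemma sink_degree_bound (r : sink n m) : exists H : Omega -> \bar R,
  [/\ measurable_fun setT H, forall w, (0 <= H w)%E,
      forall w, (sink_degree R hmn (f w) r <= H w)%E,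
      (\int[P]_w H w <= (ET_UB R (3 * m - 2) #|F|)%:E)%E
    & (1 < m)%N -> (\int[P]_w H w < (ET_UB R (3 * m - 2) #|F|)%:E)%E].
Proof.
have rn : (r + m <= n)%N by have := ltn_ord r; lia.
(* Related sinks have indices within [m - 1] of [r], so the parents lie between [r - (m - 1)] and
   [r + 2m - 2]; truncated subtraction and [minn] clip this to the layer. *)
pose lo := (r - (m - 1))%N; pose b := (minn (r + m - 1 + m) n - lo)%N.
have lobn : (lo + b <= n)%N by rewrite /lo /b; lia.
have b3 : (b <= 3 * m - 2)%N by rewrite /lo /b; lia.
have [H [mH H0 TH iH sH]] := window_time m0 hf lobn.
have UB : ((ET_UB R b #|F|)%:E <= (ET_UB R (3 * m - 2) #|F|)%:E)%E.
  by rewrite lee_fin ET_UB_le.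
exists H; split=> //.
- move=> w; apply: bigmax_le => // r' /orP[/eqP -> | /related_dist rr'].
    by apply: TH; rewrite /lo /b; lia.
  by have := ltn_ord r' => r'n; apply: TH; rewrite /lo /b; lia.
- exact: le_trans UB.
- move=> m1; apply: lt_le_trans UB; apply: sH => //; rewrite /b /lo; lia.
Qed.

Lemma inter_degree_bound (v : inter n) : exists H : Omega -> \bar R,
  [/\ measurable_fun setT H, forall w, (0 <= H w)%E,
      forall w, (inter_degree R hmn (f w) v <= H w)%E
    & (\int[P]_w H w <= (ET_UB R (2 * m) #|F|)%:E)%E].
Proof.
have vn := ltn_ord v.
(* The sinks fed by [v] have indices from [v - (m - 1)] to [v], so their parents end at
   [v + m - 1]. *)
pose lo := (v - (m - 1))%N; pose b := (minn (v + m) n - lo)%N.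
have lobn : (lo + b <= n)%N by rewrite /lo /b; lia.
have b2 : (b <= 2 * m)%N by rewrite /lo /b; lia.
have [H [mH H0 TH iH _]] := window_time m0 hf lobn.
exists H; split=> //.
  move=> w; apply: bigmax_le => // r /feedsP vr.
  by have := ltn_ord r => rn; apply: TH; rewrite /lo /b; lia.
by apply: le_trans iH _; rewrite lee_fin ET_UB_le.
Qed.

Lemma memory_degree_bound (x : node n m) : exists H : Omega -> \bar R,
  [/\ measurable_fun setT H, forall w, (0 <= H w)%E,
      forall w, (memory_degree R hmn (f w) x <= H w)%E
    & (\int[P]_w H w <= (ET_UB R (3 * m) #|F|)%:E)%E].
Proof.
have UB a : (a <= 3 * m)%N ->
    ((ET_UB R a #|F|)%:E <= (ET_UB R (3 * m) #|F|)%:E)%E.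
  by move=> h; rewrite lee_fin ET_UB_le.
case: x => [[[]|v]|r].
- exists (cst 0%E); split=> //; rewrite integral0.
  by apply: le_trans (UB 0%N _); rewrite // /ET_UB big_geq.
- have [H [mH H0 LH iH]] := inter_degree_bound v.
  by exists H; split=> //; apply: le_trans iH (UB _ _); lia.
- have [H [mH H0 LH iH _]] := sink_degree_bound r.
  by exists H; split=> //; apply: le_trans iH (UB _ _); lia.
Qed.

(** Each node contributes at most ET_UB(3m, q) + 1 in expectation, so the number of nodes cancels
    and [n] disappears. *)
Lemma average_memory_bound :
  (\int[P]_w average_memory R hmn (f w) <=
    ((Num.ceil (ln (#|F|%:R : R) / ln 2))%:~R * (ET_UB R (3 * m) #|F| + 1))%:E)%E.
Proof.
have [H hH] := choice memory_degree_bound.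
have mH x : measurable_fun setT (H x) by have [] := hH x.
have H0 x w : (0 <= H x w)%E by have [_ + _ _] := hH x; exact.
set N := #|{: node n m}|; set c : R := (Num.ceil _)%:~R.
have c0 : 0 <= c.
  rewrite ler0z; apply: le_trans (_ : Num.ceil (0 : R) <= _).
    by rewrite ceil0.
  by apply: ceil_le; rewrite divr_ge0// ln_ge0// ler1n; lia.
have N0 : (0 < N)%N by apply/card_gt0P; exists (inl (inl tt)).
have cN0 : 0 <= c / N%:R by rewrite divr_ge0.
have mH1 x : measurable_fun setT (fun w => H x w + 1)%E.
  by apply: emeasurable_funD.
have H10 x w : (0 <= H x w + 1)%E by rewrite adde_ge0.
(* The measurable majorants [H] come in before linearity of the integral is used. *)
apply: (@le_trans _ _
    (\int[P]_w ((c / N%:R)%:E * \sum_(x : node n m) (H x w + 1)))%E).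
  apply: ge0_le_integral_nonmeasurable => w.
    rewrite mule_ge0 ?lee_fin// sume_ge0// => x _.
    by rewrite adde_ge0// memory_degree_ge0.
  apply: lee_wpmul2l; rewrite ?lee_fin//; apply: lee_sum => x _.
  by rewrite leeD2r//; have [_ _ + _] := hH x; exact.
rewrite ge0_integralZl_EFin//; last 2 first.
- by move=> w _; rewrite sume_ge0.
- by apply: emeasurable_sum.
rewrite ge0_integral_sum//.
apply: (@le_trans _ _
    ((c / N%:R)%:E * \sum_(x : node n m) (ET_UB R (3 * m) #|F| + 1)%:E)%E).
  apply: lee_wpmul2l; rewrite ?lee_fin//; apply: lee_sum => x _.
  rewrite ge0_integralD// EFinD leeD//; first by have [] := hH x.
  by rewrite integral_cst// mul1e; exact: probability_le1.
rewrite sumEFin sumr_const -/N -EFinM lee_fin -[(_ + _) *+ N]mulr_natr.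
by rewrite [X in _ * X]mulrC mulrA divfK// pnatr_eq0; lia.
Qed.

End MemoryDegree.

(** Strictness is claimed for [m > 1]: when [m = 1] a sink has one parent and no related sinks, and
    its degree is geometric with mean exactly 1/(q-1) = ET_UB(1, q). *)
Theorem mainTheorem4 (R : realType) :
  exists C : nat -> nat -> R,
  forall (F : finFieldType) (n m : nat) (hm : (0 < m)%N) (hmn : (m <= n)%N)
    (d : measure_display) (Omega : measurableType d) (P : probability Omega R)
    (f : Omega -> inter n -> nat -> 'cV[F]_m),
  arcnc hmn P f ->
  [/\ forall r : sink n m,
        #|[set r' : sink n m | related hmn r r']%SET| = (2 * (m - 1))%N ->
        (\int[P]_w sink_degree R hmn (f w) r <= (ET_UB R (3 * m - 2) #|F|)%:E)%E
        /\ ((1 < m)%N ->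
            (\int[P]_w sink_degree R hmn (f w) r
               < (ET_UB R (3 * m - 2) #|F|)%:E)%E),
      forall v : inter n,
        (\int[P]_w inter_degree R hmn (f w) v <= (ET_UB R (2 * m) #|F|)%:E)%E
    & (\int[P]_w average_memory R hmn (f w) <= (C m #|F|)%:E)%E].
Proof.
exists (fun m q =>
  (Num.ceil (ln (q%:R : R) / ln 2))%:~R * (ET_UB R (3 * m) q + 1)).
move=> F n m hm hmn d Omega P f hf; split.
- move=> r _; have [H [_ H0 LH iH sH]] := sink_degree_bound hm hf r.
  have lH := ge0_le_integral_nonmeasurable P
    (fun w => memory_degree_ge0 R hmn f w (inr r)) LH.
  by split=> [|m1]; [exact: le_trans lH iH | exact: le_lt_trans lH (sH m1)].
- move=> v; have [H [_ H0 LH iH]] := inter_degree_bound hm hf v.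
  apply: le_trans iH; apply: ge0_le_integral_nonmeasurable LH => w.
  exact: (memory_degree_ge0 R hmn f w (inl (inr v))).
- exact: average_memory_bound.
Qed.
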